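(* Let $\mathbb{F}$ be any field, let $n,m\ge 1$ be integers, let $\delta\in[0,1]$, and let $A = (a_1,\ldots,a_m) \in (\mathbb{F}^n)^m$ be a special linear $(2,\delta)$-LDC. Then $$m \geq 2^{2\delta n}.$$
   Context: Write $[m]=\{1,\ldots,m\}$. $2$-matching: a $2$-matching over $[m]$ is a family $M$ of pairwise disjoint subsets of $[m]$, each of cardinality exactly $2$. Its size $|M|$ is the number of sets in $M$. Special linear $(2,\delta)$-LDC (Locally Decodable Code): a sequence $A=(a_1,\ldots,a_m)\in(\mathbb{F}^n)^m$ of $m$ vectors in $\mathbb{F}^n$ is a special linear $(2,\delta)$-LDC if for all $i\in[n]$ there exists a $2$-matching $M_i$ over $[m]$ such that (1) for every $S=\{j_1,j_2\}\in M_i$ there is a scalar $\lambda\in\mathbb{F}$ such that $\mathbf{e}_i=\lambda(a_{j_1}-a_{j_2})$, where $\mathbf{e}_i$ is the $i$-th standard basis vector of $\mathbb{F}^n$; and (2) $\sum_{i=1}^n |M_i|\ge \delta m n$. *)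

(* Defs.v *)
From mathcomp Require Import all_boot all_order all_algebra.
From mathcomp Require Import reals.

Set Implicit Arguments.
Unset Strict Implicit.
Unset Printing Implicit Defensive.

Import Order.TTheory GRing.Theory Num.Theory.

Local Open Scope ring_scope.

Definition two_matching (m : nat) (M : {set {set 'I_m}}) : Prop :=
  trivIset M /\ (forall S, S \in M -> #|S| = 2%N).

(* Vectors of F^n are row vectors, and [delta_mx 0 i] is the i-th standard
   basis vector.  Inside a 2-matching, [[set j1; j2] \in M i] forces
   [j1 != j2]. *)
Definition special_linear_2LDC (R : realType) (F : fieldType) (n m : nat)
    (delta : R) (a : 'I_m -> 'rV[F]_n) : Prop :=
  exists M : 'I_n -> {set {set 'I_m}},
    [/\ forall i, two_matching (M i),
        forall (i : 'I_n) (j1 j2 : 'I_m), [set j1; j2] \in M i ->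
          exists lambda : F, delta_mx 0 i = lambda *: (a j1 - a j2)
      & delta * m%:R * n%:R <= (\sum_(i < n) #|M i|)%:R ].

(* Main.v *)
Require Import Defs.
From mathcomp Require Import all_boot all_order all_algebra.
From mathcomp Require Import reals exp.

(** The statement is an edge-isoperimetric inequality in disguise.  Join [x]
    and [y] by an edge of direction [i] when [{x, y}] is in [M i]: the vectors
    [a x] and [a y] then differ in coordinate [i] and in no other.  The claim
    is that [m] points carry at most [(1/2) m log_2 m] edges, as in
    the hypercube.  Two points with equal coordinates may well occur; what
    replaces distinctness is that edges of the same direction are pairwise
    disjoint.

    The bound is proved for the edges inside an arbitrary set [J] of points,
    by induction on [#|J|] ([direction_edges_bound]).  If two points of [J]
    differ in coordinate [k], cut [J] into the points having one given value
    there and the rest.  Every edge across the cut has direction [k], so the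
    crossing edges are disjoint and each part has at least as many points as
    there are such edges.  Parts of sizes [x] and [y] thus contribute at most
    [min x y] crossing edges, and the induction closes with
    [min x y + f x + f y <= f (x + y)] for [f x = (1/2) x log_2 x].  In the
    exponential form [4 ^ (number of edges) <= #|J| ^ #|J|] the whole argument
    stays within the natural numbers, and this last inequality follows from
    [4 x y <= (x + y) ^ 2] ([expn_self_superadditive]).  Applied to all [m]
    points, it yields [2 ^ (2 delta n m) <= m ^ m], and it remains to take
    [m]-th roots.

    Cutting off one value of a coordinate, rather than one block per value,
    keeps every cut two-sided, so the field may be of any size. *)

Import Order.TTheory GRing.Theory Num.Theory.

Local Open Scope ring_scope.

(** For [x <= y], write the right-hand side as
    [((x + y) ^ 2) ^ x * (x + y) ^ (y - x)] and bound the two factors from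
    below by [(4 x y) ^ x] and [y ^ (y - x)]. *)
Lemma expn_self_superadditive (x y : nat) :
  (4 ^ minn x y * (x ^ x * y ^ y) <= (x + y) ^ (x + y))%N.
Proof.
wlog le_xy : x y / (x <= y)%N => [IH|].
  case/orP: (leq_total x y); first exact: IH.
  by rewrite minnC (mulnC (x ^ x)%N) (addnC x); exact: IH.
rewrite (minn_idPl le_xy).
have -> : (x + y = 2 * x + (y - x))%N.
  by rewrite mul2n -addnn -addnA subnKC.
rewrite expnD expnM -[X in (y ^ X)%N](subnKC le_xy) expnD !mulnA -!expnMn.
have -> : (2 * x + (y - x) = x + y)%N.
  by rewrite mul2n -addnn -addnA subnKC.
have leq_pow u v e : (u <= v)%N -> (u ^ e <= v ^ e)%N.
  by case: e => // e; rewrite leq_exp2r.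
apply: leq_mul; apply: leq_pow; last exact: leq_addl.
by rewrite -mulnA nat_AGM2.
Qed.

Lemma card_trivIset_meeting (T : finType) (P : {set {set T}}) (A : {set T}) :
  trivIset P -> (forall S, S \in P -> exists2 x, x \in S & x \in A) ->
  (#|P| <= #|A|)%N.
Proof.
move=> tiP meetA; apply: leq_trans (leq_imset_card (pblock P) A).
apply/subset_leq_card/subsetP => S PS; have [x Sx Ax] := meetA S PS.
by apply/imsetP; exists x; rewrite // (def_pblock tiP PS Sx).
Qed.

Section DirectionEdges.

Variables (T I : finType) (V : eqType) (X : T -> I -> V).
Variable M : I -> {set {set T}}.
Hypothesis trivM : forall i, trivIset (M i).
Hypothesis M_const : forall i k S x y,
  k != i -> S \in M i -> x \in S -> y \in S -> X x k = X y k.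
Hypothesis M_varies : forall i S,
  S \in M i -> exists x y, [/\ x \in S, y \in S & X x i != X y i].

Definition edges_within (J : {set T}) : nat := (\sum_(i : I) #|M i ::&: J|)%N.

(** Crossing edges all have direction [k]: in any other direction the two
    endpoints share coordinate [k].  Being disjoint and meeting both parts,
    they inject into each of them. *)
Lemma edges_within_cut (J : {set T}) (k : I) (v : V)
    (J0 := [set z in J | X z k == v]) (J1 := J :\: J0) :
  (edges_within J
     <= minn #|J0| #|J1| + (edges_within J0 + edges_within J1))%N.
Proof.
pose crossing i := [set S in M i ::&: J | ~~ (S \subset J0) & ~~ (S \subset J1)].
have split_edges i :
    (#|M i ::&: J| <= #|crossing i| + (#|M i ::&: J0| + #|M i ::&: J1|))%N.
  have cardU (A B : {set {set T}}) : (#|A :|: B| <= #|A| + #|B|)%N.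
    exact: leq_card_setU.
  apply: leq_trans (leq_add (leqnn _) (cardU _ _)).
  apply: leq_trans (cardU _ _); apply/subset_leq_card/subsetP => S.
  rewrite !inE => /andP[-> ->] /=.
  by case: (S \subset J0); case: (S \subset J1).
have sides i S : S \in crossing i ->
    S \in M i /\ exists x y, [/\ x \in S, y \in S, x \in J0 & y \in J1].
  rewrite !inE => /andP[/andP[MS /subsetP sSJ]].
  case/andP=> /subsetPn[y Sy J0'y] /subsetPn[x Sx J1'x].
  split=> //; exists x, y; split=> //; last by rewrite inE J0'y sSJ.
  by move: J1'x; rewrite inE sSJ // andbT negbK.
have crossing_other i : i != k -> #|crossing i| = 0%N.
  move=> neq_ik; apply/eqP; rewrite cards_eq0 -subset0.
  apply/subsetP => S /sides[MS [x [y [Sx Sy J0x]]]].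
  move: J0x; rewrite !inE => /andP[_ /eqP Xx] /andP[/negP J0y Jy].
  by case: J0y; rewrite Jy /= -Xx (M_const i k S x y) // eq_sym.
have crossing_k : (#|crossing k| <= minn #|J0| #|J1|)%N.
  have tiC : trivIset (crossing k).
    by apply: trivIsetS (trivM k); apply/subsetP => S /sides[].
  rewrite leq_min; apply/andP.
  by split; apply: (card_trivIset_meeting _ _ _ tiC) => S /sides[_ [x [y []]]];
    [exists x | exists y].
apply: leq_trans (leq_sum _ (fun i _ => split_edges i)) _.
rewrite !big_split /= leq_add2r (bigD1 k) //= big1 ?addn0 //.
Qed.

(** A set [J] whose points agree in all coordinates contains no edge.  Any
    other [J] is cut at a coordinate where two of its points differ, so that
    both parts are smaller; the exponential form turns the sum of edge counts
    into the product bounded by [expn_self_superadditive]. *)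
Lemma direction_edges_bound (J : {set T}) :
  (4 ^ edges_within J <= #|J| ^ #|J|)%N.
Proof.
have [c leJc] := ubnP #|J|; elim: c J leJc => // c IH J; rewrite ltnS => leJc.
have [/existsP[x /existsP[y /existsP[k /and3P[Jx Jy neqX]]]] | uncut] :=
  boolP [exists x, exists y, exists k, [&& x \in J, y \in J & X x k != X y k]].
  pose J0 := [set z in J | X z k == X x k]; pose J1 := J :\: J0.
  have J0x : x \in J0 by rewrite inE Jx eqxx.
  have J1y : y \in J1 by rewrite !inE Jy eq_sym (negPf neqX).
  have cardJ : #|J| = (#|J0| + #|J1|)%N.
    rewrite -(cardsID J0 J); congr (_ + _)%N.
    by apply: eq_card => z; rewrite !inE andbA andbb.
  have [J0_gt0 J1_gt0] : (0 < #|J0|)%N /\ (0 < #|J1|)%N.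
    by split; apply/card_gt0P; [exists x | exists y].
  have le0 : (4 ^ edges_within J0 <= #|J0| ^ #|J0|)%N.
    by apply: IH; apply: leq_trans leJc; rewrite cardJ -[ltnLHS]addn0 ltn_add2l.
  have le1 : (4 ^ edges_within J1 <= #|J1| ^ #|J1|)%N.
    by apply: IH; apply: leq_trans leJc; rewrite cardJ -[ltnLHS]add0n ltn_add2r.
  rewrite cardJ; apply: leq_trans (expn_self_superadditive _ _).
  apply: leq_trans (leq_mul (leqnn _) (leq_mul le0 le1)).
  by rewrite -!expnD leq_exp2l // edges_within_cut.
suff -> : edges_within J = 0%N by rewrite expn_gt0; case: #|J|.
apply: big1 => i _; apply/eqP; rewrite cards_eq0 -subset0.
apply/subsetP => S; rewrite inE => /andP[MS /subsetP sSJ].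
have [x [y [Sx Sy neqX]]] := M_varies _ _ MS; case/existsP: uncut.
by exists x; apply/existsP; exists y; apply/existsP; exists i; rewrite !sSJ.
Qed.

End DirectionEdges.

(** The scalar [lambda] cannot vanish, as coordinate [i] of the left-hand side
    is [1]. *)
Lemma scaled_sub_delta (F : fieldType) (n : nat) (i : 'I_n) (lambda : F)
    (u v : 'rV[F]_n) :
  delta_mx 0 i = lambda *: (u - v) ->
  u 0 i != v 0 i /\ forall k, k != i -> u 0 k = v 0 k.
Proof.
move/rowP => eq_uv.
have := eq_uv i; rewrite !mxE !eqxx /= => eq_i.
have nz : lambda * (u 0 i - v 0 i) != 0 by rewrite -eq_i oner_neq0.
move: nz; rewrite mulf_eq0 negb_or subr_eq0 => /andP[lambda_nz neq_i].
split=> // k neq_ki; have := eq_uv k.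
rewrite !mxE eqxx (negPf neq_ki) /= => /esym/eqP.
by rewrite mulf_eq0 (negPf lambda_nz) subr_eq0 => /eqP.
Qed.

Theorem theorem1p7 (R : realType) (F : fieldType) (n m : nat) (delta : R)
    (a : 'I_m -> 'rV[F]_n) :
  (1 <= n)%N -> (1 <= m)%N -> 0 <= delta <= 1 ->
  special_linear_2LDC delta a ->
  2 `^ (2 * delta * n%:R) <= m%:R.
Proof.
move=> _ m_gt0 _ [M [matchM decodeM sizeM]].
have pairM i S : S \in M i -> exists x y, S = [set x; y] /\
    (a x 0 i != a y 0 i /\ forall k, k != i -> a x 0 k = a y 0 k).
  move=> MS; have [_ card2] := matchM i.
  have /eqP/cards2P[x [y [_ defS]]] := card2 S MS.
  exists x, y; split=> //; move: MS; rewrite defS => /decodeM[lambda].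
  exact: scaled_sub_delta.
have := @direction_edges_bound _ _ _ (fun j i => a j 0 i) M _ _ _ [set: 'I_m].
rewrite cardsT card_ord.
have -> : edges_within _ _ M setT = (\sum_(i < n) #|M i|)%N.
  by apply: eq_bigr => i _; apply: eq_card => S; rewrite !inE subsetT andbT.
move=> bound; have {}bound : (4 ^ (\sum_(i < n) #|M i|) <= m ^ m)%N.
  apply: bound => [i | i k S x y neq_ki /pairM[x' [y' [-> [_ eq_a]]]] | i S].
  - by have [] := matchM i.
  - by rewrite !inE => /orP[]/eqP-> /orP[]/eqP->; rewrite ?(eq_a k).
  - case/pairM=> x [y [-> [neq_a _]]]; exists x, y.
    by rewrite !inE !eqxx orbT.
rewrite -(ler_pXn2r m_gt0) ?nnegrE ?powR_ge0 ?ler0n //.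
rewrite -powR_mulrn ?powR_ge0 // -powRrM -natrX.
apply: le_trans (_ : 2 `^ (2 * \sum_(i < n) #|M i|)%:R <= _).
  rewrite ler_powR ?ler1n // natrM -!mulrA ler_pM2l ?ltr0n //.
  by rewrite [n%:R * _]mulrC mulrA.
by rewrite powR_mulrn ?ler0n // -natrX expnM ler_nat.
Qed.
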